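(* Let $t\ge 2$ be an integer, and let $g_f(t)$ be the supremum of the fractional chromatic numbers $\chi_f(G)$ taken over all graphs $G$ that do not contain $K_t$ as a minor. Then every hypergraph $H$ that does not contain $K_t$ as a minor satisfies $\chi_f(H)\le 2g_f(t)$.
   Context: A hypergraph is a pair $H=(V,E)$ with $V=V(H)$ a finite set and $E=E(H)$ a set of subsets of $V$ (hyperedges), each of size at least $2$. Graphs are the hypergraphs all of whose hyperedges have size exactly $2$; $K_t$ is the complete graph on $t$ vertices. Subhypergraph: $H_1\subseteq H_2$ if $V(H_1)\subseteq V(H_2)$ and $E(H_1)\subseteq E(H_2)$. Contraction: for $e\in E(H)$ and a new vertex $v\notin V(H)$, let $\phi:V(H)\to (V(H)\setminus e)\cup\{v\}$ be the identity on $V(H)\setminus e$ and constantly $v$ on $e$. Then $H/e$ has vertex-set $(V(H)\setminus e)\cup\{v\}$ and hyperedge-set $\{\phi(f)\mid f\in E(H),\ f\not\subseteq e\}$. Minor: $H_2$ is a minor of $H_1$ if a hypergraph isomorphic to $H_2$ can be obtained from $H_1$ by a finite sequence of operations, each being either moving to a subhypergraph or contracting a hyperedge. For graphs this is the usual notion of graph minor. Fractional coloring: a set of vertices is independent in $H$ if it contains no hyperedge as a subset. A fractional coloring of $H$ assigns to every independent set $I$ of $H$ a real weight $w(I)\ge 0$ such that for every $v\in V(H)$ the sum of $w(I)$ over all independent sets $I$ containing $v$ is at least $1$; its weight is $\sum_I w(I)$. The fractional chromatic number $\chi_f(H)$ is the minimum weight of a fractional coloring of $H$. *)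

(* Defs.v *)
From HB Require Import structures.
From mathcomp Require Import all_boot all_order all_algebra.
From mathcomp Require Import all_classical all_reals all_analysis.
Set Implicit Arguments.
Unset Strict Implicit.
Unset Printing Implicit Defensive.
Import Order.TTheory GRing.Theory Num.Theory numFieldNormedType.Exports.

Record hypergraph := Hypergraph {
  vertex :> finType;
  edges : {set {set vertex}};
  edges_gt1 : forall e, e \in edges -> 1 < #|e|
}.

Definition is_graph (H : hypergraph) : Prop :=
  forall e, e \in edges H -> #|e| = 2.

Definition complete_edges (t : nat) : {set {set 'I_t}} := [set e : {set 'I_t} | #|e| == 2].

Lemma complete_edges_gt1 t e : e \in complete_edges t -> 1 < #|e|.
Proof. by rewrite inE => /eqP->. Qed.

Definition complete_graph (t : nat) : hypergraph := Hypergraph (@complete_edges_gt1 t).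

(* The subhypergraph with vertex set [W] and hyperedge set [F]. Its vertices
   form the subtype of [W], so hyperedges are pulled back along [val]; members
   of [F] not contained in [W] have no preimage and are dropped. *)
Section Subhypergraph.
Variables (H : hypergraph) (W : {set H}) (F : {set {set H}}).
Hypothesis FE : F \subset edges H.

Definition sub_edges : {set {set {x : H | x \in W}}} :=
  [set f : {set {x : H | x \in W}} | [set val x | x in f] \in F].

Lemma sub_edges_gt1 f : f \in sub_edges -> 1 < #|f|.
Proof.
by rewrite inE => /(fintype.subsetP FE)/edges_gt1; rewrite card_imset //; exact: val_inj.
Qed.

Definition subhypergraph : hypergraph := Hypergraph sub_edges_gt1.
End Subhypergraph.

(* [None] is the new vertex and [Some] embeds the complement of [e], so
   [insub] is the identity off [e] and constantly the new vertex on [e]. *)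
Section Contraction.
Variables (H : hypergraph) (e : {set H}).

Definition contract_map : H -> option {x : H | x \notin e} := insub.

Definition contract_edges : {set {set option {x : H | x \notin e}}} :=
  [set [set contract_map x | x in f] | f : {set H} in
    [set f in edges H | ~~ (f \subset e)]].

Lemma contract_edges_gt1 f : f \in contract_edges -> 1 < #|f|.
Proof.
case/imsetP => g; rewrite inE => /andP[gH /fintype.subsetPn[x xg xe]] ->.
have /card_gt1P[a [b [ag bg ab]]] := edges_gt1 gH.
have [y yg yx] : exists2 y, y \in g & y != x.
  have [ax|ax] := eqVneq a x; last by exists a.
  by exists b => //; rewrite -ax eq_sym.
apply/card_gt1P; exists (contract_map x), (contract_map y).
split; [exact: imset_f|exact: imset_f|].
have -> : contract_map x = Some (exist _ x xe) by exact: insubT.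
rewrite /contract_map; case: insubP => //= u _ uy.
by apply: contraNneq yx => -[xu]; rewrite -uy -xu.
Qed.

Definition contract : hypergraph := Hypergraph contract_edges_gt1.
End Contraction.

Definition isomorphic (H1 H2 : hypergraph) : Prop :=
  exists2 f : H1 -> H2, bijective f
    & forall e : {set H1}, ([set f x | x in e] \in edges H2) = (e \in edges H1).

Inductive reduces_to (H : hypergraph) : hypergraph -> Prop :=
| reduces_refl : reduces_to H H
| reduces_sub (H' : hypergraph) (W : {set H'}) (F : {set {set H'}})
    (FE : F \subset edges H') :
    reduces_to H H' -> reduces_to H (subhypergraph W FE)
| reduces_contract (H' : hypergraph) (e : {set H'}) :
    e \in edges H' -> reduces_to H H' -> reduces_to H (contract e).

(* [H2] is a minor of [H1]. *)
Definition minor (H2 H1 : hypergraph) : Prop :=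
  exists2 H : hypergraph, reduces_to H1 H & isomorphic H2 H.

Definition independent (H : hypergraph) (I : {set H}) : bool :=
  [forall e in edges H, ~~ (e \subset I)].

Local Open Scope ring_scope.
Local Open Scope classical_set_scope.

(* Only the values of [w] on independent sets matter. *)
Definition fractional_coloring (R : realType) (H : hypergraph)
    (w : {set H} -> R) : Prop :=
  (forall I : {set H}, independent I -> 0 <= w I) /\
  (forall v : H, 1 <= \sum_(I : {set H} | independent I && (v \in I)) w I).

Definition weight (R : realType) (H : hypergraph) (w : {set H} -> R) : R :=
  \sum_(I : {set H} | independent I) w I.

(* The infimum is a minimum: see [chi_f_min]. *)
Definition chi_f (R : realType) (H : hypergraph) : R :=
  inf [set weight w | w in @fractional_coloring R H].

Lemma independent1 (H : hypergraph) (v : H) : independent [set v]%SET.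
Proof.
apply/'forall_implyP => e eH; apply/negP => /subset_leq_card.
by rewrite cards1 leqNgt edges_gt1.
Qed.

Lemma chi_f_min (R : realType) (H : hypergraph) :
  (exists2 w, @fractional_coloring R H w & weight w = chi_f R H) /\
  (forall w, @fractional_coloring R H w -> chi_f R H <= weight w).
Proof.
pose T := prod_topology (fun _ : {set H} => (R : topologicalType)).
have projc I : continuous (fun w : T => w I).
  exact: (@proj_continuous _ (fun _ : {set H} => (R : topologicalType))).
have sumc (P : pred {set H}) : continuous (fun w : T => \sum_(I | P I) w I).
  elim: (index_enum _) => [|J s IH].
    by rewrite (_ : (fun _ => _) = cst 0); [exact: cst_continuous|
      apply/funext => w; rewrite big_nil].
  rewrite (_ : (fun _ => _) = fun w : T =>
      (if P J then w J else 0) + \sum_(I <- s | P I) w I); last first.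
    by apply/funext => w; rewrite big_cons; case: ifP; rewrite ?add0r.
  have cJ : continuous (fun w : T => if P J then w J else 0).
    by case: (P J); [exact: projc|exact: cst_continuous].
  move=> w.
  exact: (@cvgD _ _ _ (nbhs w) _ (fun w : T => if P J then w J else 0)
    (fun w : T => \sum_(I <- s | P I) w I) _ _ (cJ w) (IH w)).
have pc (f : T -> R) (A : set R) :
    continuous f -> closed A -> closed (f @^-1` A).
  by move=> /continuous_closedP; exact.
pose box : set T := [set w | forall I, `[0, 1]%classic (w I)].
have boxc : compact box.
  exact: (@tychonoff _ (fun _ : {set H} => (R : topologicalType))
    (fun=> `[0, 1]%classic) (fun=> @segment_compact R 0 1)).
pose S : set T := box `&` \bigcap_(v in @setT H)
  [set w | 1 <= \sum_(I : {set H} | independent I && (v \in I)) w I].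
have Sc : compact S.
  apply: (subclosed_compact _ boxc); last by apply: subIsetl.
  apply: closedI.
    rewrite (_ : box = \bigcap_(I in @setT {set H}) [set w | `[0, 1]%classic (w I)]).
      apply: closed_bigI => I _; apply: (pc (fun w : T => w I)) => //.
      exact: interval_closed.
    by apply/seteqP; split=> [w wb I _|w wb I]; [exact: wb|exact: (wb I Logic.I)].
  apply: closed_bigI => v _.
  exact: (pc _ _ (sumc (fun I => independent I && (v \in I))) (@closed_ge R 1)).
have SE w : S w -> @fractional_coloring R H w.
  move=> [wb wv]; split => [I _|v]; last exact: wv.
  by have := wb I; rewrite /= in_itv /= => /andP[].
pose clip (w : {set H} -> R) : T :=
  fun I => if independent I then Num.min (w I) 1 else 0.
have clipS w : @fractional_coloring R H w -> S (clip w) /\ weight (clip w) <= weight w.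
  move=> [w0 wv].
  have c0 I : 0 <= clip w I.
    by rewrite /clip; case: ifP => // /w0 wI; rewrite le_min wI ler01.
  split; last first.
    by apply: ler_sum => I iI; rewrite /clip iI ge_min lexx.
  split => [I|v _] /=.
    rewrite in_itv /= c0 /= /clip; case: ifP => // _.
    by rewrite ge_min lexx orbT.
  have [[I /andP[/andP[iI vI] I1]]|small] := pselect (exists I,
      independent I && (v \in I) && (1 <= w I)).
    rewrite (bigD1 I) ?iI //= /clip iI min_r // lerDl.
    by apply: sumr_ge0 => J _; exact: c0.
  apply: le_trans (wv v) _; apply: ler_sum => I iI; rewrite /clip.
  case/andP: (iI) => -> vI; rewrite le_min lexx /=.
  by rewrite leNgt; apply/negP => /ltW I1; apply: small; exists I; rewrite iI.
have S0 : S !=set0.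
  exists (clip (fun=> 1)); apply: (clipS _ _).1; split => // v.
  rewrite (bigD1 [set v]%SET) /=; last by rewrite independent1 set11.
  rewrite lerDl.
  exact: sumr_ge0.
have [c /set_mem cS cmin] := compact_EVT_min S0 Sc
  (continuous_subspaceT (sumc (@independent H))).
have cle w : @fractional_coloring R H w -> weight c <= weight w.
  by move=> /clipS[wS]; apply: le_trans; apply: cmin; exact/mem_set.
have cE : weight c = chi_f R H.
  apply/eqP; rewrite eq_le; apply/andP; split.
    apply: lb_le_inf; first by exists (weight c), c => //; exact: SE.
    by move=> _ [w /cle wc <-].
  apply: ge_inf; last by exists c => //; exact: SE.
  by exists (weight c) => _ [w /cle wc <-].
by split; [exists c => //; exact: SE|move=> w /cle; rewrite cE].
Qed.

(* A supremum in the extended reals: no boundedness is presupposed. *)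
Definition g_f (R : realType) (t : nat) : \bar R :=
  ereal_sup [set x : \bar R | exists G : hypergraph,
    [/\ is_graph G, ~ minor (complete_graph t) G & x = (chi_f R G)%:E]].

(* Main.v *)
Require Import Defs.
From mathcomp Require Import all_boot all_order all_algebra.
From mathcomp Require Import all_classical all_reals all_analysis.
Import Order.TTheory GRing.Theory Num.Theory.
Import mathcomp.boot.fintype mathcomp.boot.finset.
Local Open Scope ring_scope.

(** The vertices of H are partitioned into connected parts, each carrying a
    2-coloring, so that contracting the parts and keeping only the hyperedges
    of size 2 yields a graph G, a minor of H, with the following property: every
    inclusion-minimal hyperedge e of H either has two vertices of the same part
    with different colors, or meets two parts that are adjacent in G.  Hence, if
    I is independent in G and c is one of the two colors, the vertices of color
    c lying in the parts of I form an independent set of H.  Splitting each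
    weight of an optimal fractional coloring of G in this way gives
    chi_f(H) <= 2 chi_f(G) ([chi_f_le_mul]), and G has no K_t minor because the
    minor relation is transitive.

    The parts are chosen greedily.  Among the vertices U not yet covered, take
    a maximal set X that is connected and has no monochromatic minimal
    hyperedge for some 2-coloring.  The point ([exists_saturated]) is that a
    minimal hyperedge e inside U that crosses the boundary of X then has a vertex
    v outside X such that some hyperedge in X + v contains v: otherwise some
    minimal hyperedge f could be added to X, since f adds at least two vertices,
    and giving both colors to these new vertices leaves nothing monochromatic.
    After contraction, that hyperedge in X + v becomes an edge of G between two
    parts met by e. *)

Set Implicit Arguments.
Unset Strict Implicit.
Unset Printing Implicit Defensive.

(** * Maximal connected 2-colorable vertex sets *)

Section Growing.
Variables (T : finType) (M : {set {set T}}).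

Inductive linked : {set T} -> Prop :=
| linked1 v : linked [set v]
| linkedU (X e : {set T}) :
    linked X -> e \in M -> e :&: X != set0 -> linked (e :|: X).

Lemma linked_neq0 X : linked X -> X != set0.
Proof.
elim=> [v|Y e _ + _ _]; first by apply/set0Pn; exists v; rewrite set11.
by case/set0Pn => y yY; apply/set0Pn; exists y; rewrite inE yY orbT.
Qed.

Definition splits (b : T -> bool) (e : {set T}) : Prop :=
  exists u v, [/\ u \in e, v \in e & b u != b v].

Definition bicolors (b : T -> bool) (X : {set T}) : Prop :=
  forall e, e \in M -> e \subset X -> splits b e.

Hypothesis M_gt1 : forall e, e \in M -> (1 < #|e|)%N.
Hypothesis M_antichain : forall e f, e \in M -> f \in M -> e \subset f -> e = f.

(** Maximality of X is used against X + f, where f is a hyperedge in M crossing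
    the boundary of X for which D = f - X is minimal.  If D were a single vertex,
    it would be the required v.  Otherwise both colors occur on D.  A hyperedge
    of M inside X + f but not inside X that meets X contains all of D, by the
    choice of f, so it sees both colors; one that avoids X would be a proper
    subset of f, which the antichain condition excludes. *)
Lemma exists_saturated (U : {set T}) : U != set0 ->
  exists (X : {set T}) (b : T -> bool), [/\ X \subset U, linked X, bicolors b X &
    forall e, e \in M -> e \subset U -> e :&: X != set0 -> ~~ (e \subset X) ->
      exists (v : T) (f : {set T}),
        [/\ v \in e :\: X, f \in M, v \in f & f \subset v |: X]].
Proof.
case/set0Pn => x0 x0U.
pose P (X : {set T}) := `[< [/\ X \subset U, linked X & exists b, bicolors b X] >].
have Px0 : P [set x0].
  apply/asboolP; split; [by rewrite sub1set|exact: linked1|].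
  exists (fun=> true) => e eM /subset_leq_card.
  by rewrite cards1 leqNgt M_gt1.
have [X maxX _] := maxset_exists Px0.
have /asboolP[XU Xl [b bX]] := maxsetp maxX.
exists X, b; split=> // e eM eU eX eNX.
apply: contrapT => noedge.
pose Q (D : {set T}) := (D != set0) &&
  [exists f in M, (f :\: X == D) && (f :&: X != set0)].
have Qe : Q (e :\: X).
  rewrite /Q setD_eq0 eNX /=.
  by apply/existsP; exists e; rewrite eM eqxx.
have [D minD De] := minset_exists Qe.
have /andP[D0 /existsP[f /and3P[fM /eqP fD fX]]] := minsetp minD.
have fXU : f :|: X \subset U.
  rewrite subUset XU andbT; apply/subsetP => y yf.
  have [yX|yNX] := boolP (y \in X); first exact: (subsetP XU).
  have : y \in e :\: X by rewrite (subsetP De) // -fD inE yNX.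
  by case/setDP => ye _; exact: (subsetP eU).
have D1 : (1 < #|D|)%N.
  rewrite ltn_neqAle eq_sym card_gt0 D0 andbT.
  apply/negP => /cards1P[v Dv]; apply: noedge; exists v, f.
  have vf : v \in f :\: X by rewrite fD Dv set11.
  split=> //; first by rewrite (subsetP De) // Dv set11.
    by case/setDP: vf.
  by rewrite -[f](setID _ X) fD Dv setUC setUS // subsetIr.
have /card_gt1P[d0 [d1 [d0D d1D d01]]] := D1.
have DX d : d \in D -> (d \in X) = false by rewrite -fD => /setDP[_ /negPf].
pose b' v := if v \in X then b v else v == d0.
have bfX : bicolors b' (f :|: X).
  move=> g gM gfX; have [gX|gNX] := boolP (g \subset X).
    have [u [v [ug vg buv]]] := bX g gM gX; exists u, v; split=> //.
    by rewrite /b' !(subsetP gX).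
  have gD : g :\: X \subset D by have := setSD X gfX; rewrite setDUl setDv setU0 fD.
  have gX0 : g :&: X != set0.
    apply: contraNneq fX => gX0.
    rewrite -(M_antichain gM fM) ?gX0 //.
    rewrite -[g](setID _ X) gX0 set0U; apply: fintype.subset_trans gD _.
    by rewrite -fD subsetDl.
  have Dg : g :\: X = D.
    apply: (minsetinf minD) => //; rewrite /Q setD_eq0 gNX.
    by apply/existsP; exists g; rewrite gM eqxx.
  exists d0, d1; rewrite /b' !DX // eqxx (eq_sym d1) (negPf d01); split=> //.
    by move: d0D; rewrite -Dg => /setDP[].
  by move: d1D; rewrite -Dg => /setDP[].
have PfX : P (f :|: X).
  by apply/asboolP; split; [|exact: linkedU|exists b'].
have fXX := maxsetsup maxX PfX (subsetUr _ _).
by move: D0; rewrite -fD setD_eq0 -fXX subsetUl.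
Qed.

End Growing.

(** * Contracting a connected set *)

Lemma reduces_to_trans H1 H2 H3 :
  reduces_to H1 H2 -> reduces_to H2 H3 -> reduces_to H1 H3.
Proof.
move=> r12; elim=> [//|H' W F FE _ r|H' e eH _ r]; first exact: reduces_sub.
exact: reduces_contract.
Qed.

(** Hyperedges with a one-vertex image are exempted because contracting e drops
    the hyperedges inside e. *)
Definition edge_preserving (H G : hypergraph) (q : H -> G) : Prop :=
  forall e, e \in edges H -> (1 < #|q @: e|)%N -> q @: e \in edges G.

(** A hyperedge that becomes a single vertex under [q] adds nothing to the image
    of a set that it meets, so it can be left out of the sequence. *)
Lemma linked_image (H G : hypergraph) (q : H -> G) (M : {set {set H}}) X :
  M \subset edges H -> edge_preserving q ->
  linked M X -> linked (edges G) (q @: X).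
Proof.
move=> ME qE; elim=> [v|Y e _ lY eM eY]; first by rewrite imset_set1; left.
have [x /setIP[xe xY]] := set0Pn _ eY.
rewrite imsetU; have [e1|e1] := ltnP 1 #|q @: e|.
  right=> //; first by apply: qE e1; exact: (subsetP ME).
  by apply/set0Pn; exists (q x); rewrite inE !imset_f.
have /card_le1_eqP qe := e1.
suff /setUidPr-> : q @: e \subset q @: Y by [].
apply/subsetP => z ze; rewrite -(qe z (q x) ze) ?imset_f //.
Qed.

Lemma contract_map_eq (H : hypergraph) (e : {set H}) (x y : H) :
  contract_map e x = contract_map e y <-> x = y \/ x \in e /\ y \in e.
Proof.
rewrite /contract_map; split=> [|[->//|[xe ye]]]; last first.
  by rewrite !insubF ?xe ?ye.
case: insubP => [u xe ux|/negPn xe]; case: insubP => [v ye vy|/negPn ye] //.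
  by case=> uv; left; rewrite -ux -vy uv.
by right.
Qed.

(** The hyperedges that build up [Y] are contracted one after the other.  If one
    of them has already become a single vertex, then it lies in the part of [Y]
    contracted so far, and there is nothing to do. *)
Lemma contract_linked (G : hypergraph) (Y : {set G}) : linked (edges G) Y ->
  exists (G' : hypergraph) (p : G -> G'), [/\ reduces_to G G', edge_preserving p &
    forall x y, p x = p y <-> x = y \/ x \in Y /\ y \in Y].
Proof.
elim=> [v|{}Y e _ [G' [p [rG pE pY]]] eG /set0Pn[z /setIP[ze zY]]].
  exists G, id; split=> [|e eG _|x y]; [exact: reduces_refl|by rewrite imset_id|].
  by split=> [|[//|[/set1P-> /set1P->]]]; first by left.
have pe x : (p x \in p @: e) = (x \in e :|: Y).
  apply/imsetP/setUP => [[y ye /pY[->|[xY _]]]|[xe|xY]].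
  - by left.
  - by right.
  - by exists x.
  - by exists z => //; apply/pY; right.
have [e1|e1] := ltnP 1 #|p @: e|; last first.
  have /card_le1_eqP pe1 := e1.
  suff /setUidPr-> : e \subset Y by exists G', p.
  apply/subsetP => x xe.
  by have /pY[->|[]] := pe1 _ _ (imset_f p ze) (imset_f p xe).
exists (Defs.contract (p @: e)), (contract_map (p @: e) \o p); split.
- by apply: reduces_contract rG; exact: pE.
- move=> f fG; rewrite (imset_comp (contract_map (p @: e)) p f) => f1.
  apply: imset_f.
  rewrite inE; apply/andP; split.
    by apply: pE => //; apply: leq_trans f1 _; exact: leq_imset_card.
  apply: contraL f1 => /subsetP fe; rewrite -leqNgt.
  apply/card_le1_eqP => _ _ /imsetP[x xf ->] /imsetP[y yf ->].
  by apply/contract_map_eq; right; rewrite !fe.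
- move=> x y /=; rewrite contract_map_eq !pe pY !inE.
  split=> [[[->|[xY yY]]|xy]|[->|xy]]; [left|right|right|left; left|right] => //.
  by rewrite xY yY !orbT.
Qed.

(** * Greedy decomposition into parts *)

Section Decomposition.
Variables (H : hypergraph) (M : {set {set H}}).
Hypothesis ME : M \subset edges H.
Hypothesis M_antichain : forall e f, e \in M -> f \in M -> e \subset f -> e = f.

(** The first vertex of the witness lies outside the uncovered set [U], hence in
    a finished part.  This is what keeps the witness valid when a further part
    inside [U] is contracted: the two vertices of the edge of [G] cannot be
    merged. *)
Definition resolved (G : hypergraph) (q : H -> G) (b : H -> bool)
    (U e : {set H}) : Prop :=
  exists u v, [/\ u \in e :\: U, v \in e &
    (v \notin U /\ q u = q v /\ b u != b v) \/ [set q u; q v] \in edges G].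

(** The state of the greedy process when the vertices of [U] remain: the fibers
    of [q] are the parts already contracted and the singletons of [U]. *)
Definition partial_decomposition (U : {set H}) : Prop :=
  exists (G : hypergraph) (q : H -> G) (b : H -> bool),
  [/\ reduces_to H G, edge_preserving q,
      forall u v, u \in U -> q u = q v -> u = v &
      forall e, e \in M -> ~~ (e \subset U) -> resolved q b U e].

(** The set X of [exists_saturated] becomes the next part.  A hyperedge of M that
    is not inside U keeps its old witness.  One inside U that meets X is either
    inside X, where the coloring of X splits it, or crosses the boundary of X,
    where the saturation of X provides an edge of the contracted hypergraph. *)
Lemma partial_decomposition_step (U : {set H}) : U != set0 -> partial_decomposition U ->
  exists2 U' : {set H}, U' \proper U & partial_decomposition U'.
Proof.
move=> U0 [G [q [b [rG qE qU qb]]]].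
have M1 e : e \in M -> (1 < #|e|)%N.
  by move=> eM; apply: (@edges_gt1 H); exact: (subsetP ME).
have [X [c [XU Xl cX Xsat]]] := exists_saturated M1 M_antichain U0.
have [G' [p [rG' pE pX]]] := contract_linked (linked_image ME qE Xl).
have [x0 x0X] := set0Pn _ (linked_neq0 Xl).
have qX u : (q u \in q @: X) = (u \in X).
  apply/imsetP/idP => [[x xX] quv|uX]; last by exists u.
  by rewrite -(qU x u) // (subsetP XU).
have pqX u v : p (q u) = p (q v) <-> q u = q v \/ u \in X /\ v \in X.
  by rewrite pX !qX.
have pqE : edge_preserving (p \o q).
  move=> e eH; rewrite (imset_comp p q e) => e1; apply: pE => //; apply: qE => //.
  by apply: leq_trans e1 _; exact: leq_imset_card.
exists (U :\: X).
  apply/properP; split; first exact: subsetDl.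
  by exists x0; [exact: (subsetP XU)|rewrite inE x0X].
exists G', (p \o q), (fun v => if v \in X then c v else b v).
split=> //; first exact: reduces_to_trans rG rG'.
  move=> u v /setDP[uU uX] /pqX[|[]]; first exact: qU.
  by rewrite (negPf uX).
move=> e eM eUX; have [eU|eU] := boolP (e \subset U); last first.
  have NX u : u \notin U -> (u \in X) = false.
    by move=> uU; apply: contraNF uU; exact: (subsetP XU).
  have [u [v [/setDP[ue uU] ve uv]]] := qb e eM eU.
  exists u, v; split=> //; first by rewrite !inE (negPf uU) andbF ue.
  case: uv => [[vU [quv buv]]|quv]; [left|right].
    by rewrite inE (negPf vU) andbF !NX //= quv.
  have := pE _ quv; rewrite imsetU1 imset_set1; apply.
  (* The edge between q u and q v survives because u is not in X. *)
  have := edges_gt1 quv; rewrite !cards2 !ltnS !lt0b.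
  apply: contra => /eqP/pqX[->//|[]]; by rewrite NX.
have eX : e :&: X != set0.
  apply: contra eUX => /eqP eX; rewrite subsetD eU /=.
  by rewrite -setI_eq0 eX.
have [u /setIP[ue uX]] := set0Pn _ eX.
have [eXX|eNX] := boolP (e \subset X).
  have [y [z [ye ze cyz]]] := cX e eM eXX.
  have [yX zX] : y \in X /\ z \in X by rewrite !(subsetP eXX).
  exists y, z; split=> //; first by rewrite !inE yX ye.
  left; rewrite !inE yX zX; split=> //; split=> //.
  by apply/pqX; right.
have [v [f [/setDP[ve vX] fM vf fX]]] := Xsat e eM eU eX eNX.
exists u, v; split=> //; first by rewrite !inE uX ue.
right.
have uv : p (q u) != p (q v).
  apply/eqP => /pqX[quv|[_]]; last by rewrite (negPf vX).
  by case/negP: vX; rewrite -(qU u v) // (subsetP XU).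
have pqf x : x \in X -> p (q x) = p (q u) by move=> xX; apply/pqX; right.
have [a af aX] : exists2 a, a \in f & a \in X.
  have /card_gt1P[a [a' [af a'f aa']]] := M1 f fM.
  have := subsetP fX _ af; rewrite !inE => /orP[/eqP av|]; last by exists a.
  have := subsetP fX _ a'f; rewrite !inE => /orP[/eqP av'|]; last by exists a'.
  by rewrite av av' eqxx in aa'.
have fE : (p \o q) @: f = [set p (q u); p (q v)].
  apply/setP => z; apply/imsetP/set2P => [[x xf ->]|[->|->]].
  - have := subsetP fX _ xf; rewrite !inE => /orP[/eqP->|/pqf]; first by right.
    by left.
  - by exists a => //=; rewrite pqf.
  - by exists v.
rewrite -fE; apply: pqE; first exact: (subsetP ME).
by rewrite fE cards2 uv.
Qed.

Lemma decomposition : partial_decomposition set0.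
Proof.
have [n] := ubnP #|[set: H]|.
have : partial_decomposition [set: H].
  exists H, id, (fun=> true); split=> //; first exact: reduces_refl.
    by move=> e eH _; rewrite imset_id.
  by move=> e _; rewrite subsetT.
elim: n [set: H] => // n IH U dU Un.
have [<-//|U0] := eqVneq U set0.
have [U' U'U dU'] := partial_decomposition_step U0 dU.
by apply: (IH U') => //; exact: leq_trans (proper_card U'U) Un.
Qed.

End Decomposition.

(** * Pulling back fractional colorings *)

(** Every hyperedge contains an inclusion-minimal one, so it suffices to keep
    the sets free of minimal hyperedges; these form the antichain that the greedy
    decomposition requires. *)
Lemma graph_minor_bicoloring (H : hypergraph) :
  exists (G : hypergraph) (q : H -> G) (b : H -> bool),
  [/\ reduces_to H G, is_graph G &
    forall (I : {set G}) c, independent I ->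
      independent [set v | (q v \in I) && (b v == c)]].
Proof.
pose M := [set e | minset (fun e => e \in edges H) e].
have ME : M \subset edges H.
  by apply/subsetP => e; rewrite inE => /minsetp.
have M_antichain e f : e \in M -> f \in M -> e \subset f -> e = f.
  by rewrite !inE => /minsetp eH /minsetinf; apply.
have [G [q [b [rG qE _ qb]]]] := decomposition ME M_antichain.
pose F := [set e in edges G | #|e| == 2%N].
have FE : F \subset edges G by apply/subsetP => e; rewrite inE => /andP[].
pose s (x : G) : subhypergraph [set: G] FE := exist _ x (in_setT x).
exists (subhypergraph [set: G] FE), (s \o q), b; split.
- exact: reduces_sub.
- move=> e; rewrite !inE => /andP[_ /eqP].
  by rewrite card_imset //; exact: val_inj.
move=> I c /'forall_implyP Iind; apply/'forall_implyP => e eH; apply/negP => eI.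
have [m mM me] := minset_exists (P := fun e => e \in edges H) eH.
have mI x : x \in m -> (s (q x) \in I) && (b x == c).
  by move=> /(subsetP me)/(subsetP eI); rewrite inE.
have [||u [v [/setDP[um _] vm]]] := qb m.
- by rewrite inE.
- rewrite subset0 -card_gt0; apply: ltnW; apply: (@edges_gt1 H).
  exact: minsetp mM.
have /andP[uI /eqP bu] := mI u um; have /andP[vI /eqP bv] := mI v vm.
case=> [[_ [_]]|uv]; first by rewrite bu bv eqxx.
suff sE : [set s (q u); s (q v)] \in edges (subhypergraph [set: G] FE).
  by have := Iind _ sE; rewrite subUset !sub1set uI vI.
rewrite inE imsetU1 imset_set1 inE uv /=.
by have := edges_gt1 uv; rewrite cards2; case: (_ != _).
Qed.

(** An optimal coloring [w] of [G] is pulled back by giving the weight [w I] to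
    each of the #|C| sets cut out by [I] and a color.  Different pairs may cut
    out the same set, hence the sum in [w'].  A vertex [v] is covered once for each
    [I] containing [q v], namely by the color [b v]. *)
Lemma chi_f_le_mul (R : realType) (H G : hypergraph) (C : finType)
    (q : H -> G) (b : H -> C) :
  (forall (I : {set G}) c, independent I ->
    independent [set v | (q v \in I) && (b v == c)]) ->
  chi_f R H <= #|C|%:R * chi_f R G.
Proof.
move=> ind.
have [[w [w0 w1] <-] _] := chi_f_min R G.
pose A (x : {set G} * C) := [set v | (q v \in x.1) && (b v == x.2)].
pose w' J := \sum_(x | independent x.1 && (A x == J)) w x.1.
(* Sums of w' are sums over pairs: group the pairs by the set they cut out. *)
have w'E (P : pred {set H}) :
    \sum_(J | independent J && P J) w' J =
    \sum_(x | independent x.1 && P (A x)) w x.1.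
  rewrite (partition_big A (fun J => independent J && P J)) /=; last first.
    by move=> [I c] /= /andP[iI ->]; rewrite ind.
  apply: eq_bigr => J /andP[_ PJ]; apply: eq_bigl => x.
  by case: eqP => [->|]; rewrite ?andbF // PJ !andbT.
have w'P : fractional_coloring w'.
  split=> [J _|v]; first by apply: sumr_ge0 => x /andP[/w0].
  rewrite w'E.
  apply: le_trans (w1 (q v)) _.
  rewrite (eq_bigl (fun x : {set G} * C =>
    (independent x.1 && (q v \in x.1)) && (x.2 == b v))); last first.
    by move=> x; rewrite inE eq_sym andbA.
  rewrite -(pair_big (fun I => independent I && (q v \in I)) (pred1 (b v))
    (fun I _ => w I)) /=.
  by apply: ler_sum => I _; rewrite big_pred1_eq.
have [_ /(_ _ w'P)] := chi_f_min R H.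
move=> /le_trans; apply; rewrite /weight.
rewrite (eq_bigl (fun J => independent J && true)); last by move=> J; rewrite andbT.
rewrite (w'E predT).
rewrite (eq_bigl (fun x : {set G} * C => independent x.1 && predT x.2)); last by [].
rewrite -(pair_big (@independent G) predT (fun I _ => w I)) /= mulr_sumr.
by apply: ler_sum => I _; rewrite sumr_const mulr_natl cardT -cardE.
Qed.

Theorem proposition1 (R : realType) (t : nat) (ht : (2 <= t)%N)
  (H : hypergraph) (hH : ~ minor (complete_graph t) H) :
  ((chi_f R H)%:E <= 2%:E * g_f R t)%E.
Proof.
have [G [q [b [rG Ggraph ind]]]] := graph_minor_bicoloring H.
have le2 : chi_f R H <= 2 * chi_f R G.
  by rewrite -card_bool; exact: chi_f_le_mul ind.
apply: (@le_trans _ _ (2%:E * (chi_f R G)%:E)%E); first by rewrite -EFinM lee_fin.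
apply: lee_wpmul2l; first by rewrite lee_fin.
apply: ereal_sup_ubound; exists G; split=> // -[K rK iK].
by apply: hH; exists K => //; exact: reduces_to_trans rG rK.
Qed.
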